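(* Let $R$ be an abelian $*$-ring with unity. Then $\Gamma'(R)$ is complete if and only if either $R\simeq\mathbb{Z}_2\oplus\mathbb{Z}_2$ or $Z^*(R)$ is a set of nilpotent elements of $R$ (i.e. every element of $Z^*(R)$ is nilpotent). Further, if $R$ is a commutative ring and $\Gamma'(R)=K_n$ with $n>2$, then $Z(R)$ is a $*$-ideal of $R$.
   Context: A $*$-ring is a ring $R$ with a map $*:R\to R$ (an involution) satisfying $(x+y)^*=x^*+y^*$, $(xy)^*=y^*x^*$ and $(x^* )^*=x$ for all $x,y\in R$. A projection is an element $e\in R$ with $e^2=e=e^*$; a $*$-ring is abelian if all its projections are central. $Z(R)$ denotes the set of all zero-divisors of $R$ (left or right, including $0$), and $Z^*(R)$ the set of all non-zero zero-divisors. The generalized zero-divisor graph $\Gamma'(R)$ is the simple undirected graph with vertex set $Z^*(R)$ in which two distinct vertices $x,y$ are adjacent if and only if $x^ny^*=0$ or $y^nx^*=0$ for some positive integer $n$. $K_n$ is the complete graph on $n$ vertices. An ideal $I$ of a $*$-ring is a $*$-ideal if $a^*\in I$ whenever $a\in I$. *)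

(* Defs.v *)
From HB Require Import structures.
From mathcomp Require Import all_boot all_order all_algebra.

Set Implicit Arguments.
Unset Strict Implicit.
Unset Printing Implicit Defensive.

Import GRing.Theory.
Local Open Scope ring_scope.

(* The base structure is pzRingType: a ring with unity, the trivial ring not
   being excluded. *)
HB.mixin Record isStarRing R of GRing.PzRing R := {
  star : R -> R;
  starD : forall x y : R, star (x + y) = star x + star y;
  starM : forall x y : R, star (x * y) = star y * star x;
  starK : forall x : R, star (star x) = x
}.

#[short(type="starRingType")]
HB.structure Definition StarRing := {R of GRing.PzRing R & isStarRing R}.

(* The identity is the only involution of 'Z_p, since the unit generates the
   additive group. *)
HB.instance Definition _ (p : nat) :=
  isStarRing.Build 'I_p.+2 (star := id)
    (fun _ _ => erefl) (@mulrC 'I_p.+2) (fun _ => erefl).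

Section DirectSum.
Variables R S : starRingType.

Definition pair_star (x : R * S) : R * S := (star x.1, star x.2).

Fact pair_starD (x y : R * S) : pair_star (x + y) = pair_star x + pair_star y.
Proof. by congr (_, _); rewrite /= starD. Qed.

Fact pair_starM (x y : R * S) : pair_star (x * y) = pair_star y * pair_star x.
Proof. by congr (_, _); rewrite /= starM. Qed.

Fact pair_starK (x : R * S) : pair_star (pair_star x) = x.
Proof. by case: x => x y; rewrite /pair_star /= !starK. Qed.

HB.instance Definition _ :=
  isStarRing.Build (R * S)%type pair_starD pair_starM pair_starK.

End DirectSum.

(* Isomorphism of *-rings. Compatibility with the involutions matters: the ring
   Z_2 + Z_2 with the involution exchanging the two summands is abelian, and its
   two non-zero zero-divisors are not adjacent in the graph below. *)
Definition star_isomorphic (R S : starRingType) : Prop :=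
  exists f : {rmorphism R -> S},
    bijective f /\ (forall x : R, f (star x) = star (f x)).

Section StarRingNotions.
Variable R : starRingType.

Definition projection (e : R) : Prop := e ^+ 2 = e /\ star e = e.

Definition abelian_star_ring : Prop :=
  forall e : R, projection e -> forall x : R, e * x = x * e.

(* The first disjunct is only needed in the trivial ring. *)
Definition zero_divisor (x : R) : Prop :=
  x = 0 \/ exists2 y : R, y <> 0 & x * y = 0 \/ y * x = 0.

Definition nonzero_zero_divisor (x : R) : Prop := zero_divisor x /\ x <> 0.

Definition nilpotent_elt (x : R) : Prop :=
  exists2 n : nat, (0 < n)%N & x ^+ n = 0.

Definition ideal (I : R -> Prop) : Prop :=
  [/\ I 0,
      forall x y : R, I x -> I y -> I (x - y) &
      forall a x : R, I x -> I (a * x) /\ I (x * a)].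

Definition star_ideal (I : R -> Prop) : Prop :=
  ideal I /\ (forall x : R, I x -> I (star x)).

End StarRingNotions.

Record simple_graph (T : Type) : Type := SimpleGraph {
  vertex : T -> Prop;
  adjacent : T -> T -> Prop;
  adjacent_vertex : forall x y : T, adjacent x y -> vertex x /\ vertex y;
  adjacent_sym : forall x y : T, adjacent x y -> adjacent y x;
  adjacent_irrefl : forall x : T, ~ adjacent x x
}.

Definition complete (T : Type) (G : simple_graph T) : Prop :=
  forall x y : T, vertex G x -> vertex G y -> x <> y -> adjacent G x y.

Definition graph_isomorphic (T U : Type)
    (G : simple_graph T) (H : simple_graph U) : Prop :=
  exists f : T -> U,
    [/\ forall x, vertex G x -> vertex H (f x),
        forall x y, vertex G x -> vertex G y -> f x = f y -> x = y,
        forall u, vertex H u -> exists2 x, vertex G x & f x = u &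
        forall x y, vertex G x -> vertex G y ->
          (adjacent G x y <-> adjacent H (f x) (f y))].

Section CompleteGraph.
Variable n : nat.

Definition K_adjacent (i j : 'I_n) : Prop := i <> j.

Fact K_adjacent_vertex (i j : 'I_n) : K_adjacent i j -> True /\ True.
Proof. by []. Qed.

Fact K_adjacent_sym (i j : 'I_n) : K_adjacent i j -> K_adjacent j i.
Proof. by move=> ij ji; apply: ij. Qed.

Fact K_adjacent_irrefl (i : 'I_n) : ~ K_adjacent i i.
Proof. by move=> ii; apply: ii. Qed.

Definition complete_graph : simple_graph 'I_n :=
  @SimpleGraph 'I_n (fun=> True) K_adjacent
    K_adjacent_vertex K_adjacent_sym K_adjacent_irrefl.

End CompleteGraph.

Section ZeroDivisorGraph.
Variable R : starRingType.

Definition zdg_adjacent (x y : R) : Prop :=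
  [/\ nonzero_zero_divisor x, nonzero_zero_divisor y, x <> y &
      exists2 n : nat, (0 < n)%N & x ^+ n * star y = 0 \/ y ^+ n * star x = 0].

Fact zdg_adjacent_vertex (x y : R) :
  zdg_adjacent x y -> nonzero_zero_divisor x /\ nonzero_zero_divisor y.
Proof. by case. Qed.

Fact zdg_adjacent_sym (x y : R) : zdg_adjacent x y -> zdg_adjacent y x.
Proof.
case=> Zx Zy xy [n n0 xyn]; split=> //; first by move=> yx; apply: xy.
by exists n => //; case: xyn; [right | left].
Qed.

Fact zdg_adjacent_irrefl (x : R) : ~ zdg_adjacent x x.
Proof. by case=> _ _ xx _; apply: xx. Qed.

Definition generalized_zero_divisor_graph : simple_graph R :=
  @SimpleGraph R (@nonzero_zero_divisor R) zdg_adjacent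
    zdg_adjacent_vertex zdg_adjacent_sym zdg_adjacent_irrefl.

End ZeroDivisorGraph.

(* Main.v *)
(** Two applications of completeness force a non-nilpotent non-zero zero-divisor
    [x] to be a projection: if [x] differs from its adjoint, adjacency of the two
    makes [x] nilpotent, and if [x] differs from [x ^+ 2], so does adjacency of
    those two. Such a projection [e] is central, so [R] splits as
    [e R + (1 - e) R]. An element of [e R] other than [0] and [e] would be
    nilpotent, being adjacent to [e], and so would its difference with [e]; but
    the latter is a unit of [e R]. Hence [e R = {0, e}], likewise for [1 - e],
    and [R] has the four elements [0], [e], [1 - e], [1]. *)

Require Import Defs.
From HB Require Import structures.
From mathcomp Require Import all_boot all_order all_algebra.
From mathcomp Require boolp.

Set Implicit Arguments.
Unset Strict Implicit.
Unset Printing Implicit Defensive.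

Import GRing.Theory.
Local Open Scope ring_scope.

(** * Involutions, idempotents, nilpotents and zero-divisors *)

Section StarRingLemmas.
Variable R : starRingType.
Implicit Types x y e : R.

Lemma star0 : star (0 : R) = 0.
Proof. by apply: (addrI (star (0 : R))); rewrite -starD !addr0. Qed.

Lemma starN x : star (- x) = - star x.
Proof. by apply/eqP; rewrite -addr_eq0 -starD addNr star0. Qed.

Lemma star1 : star (1 : R) = 1.
Proof. by rewrite -[LHS]mul1r -[X in X * _]starK -starM mul1r starK. Qed.

Lemma star_eq0 x : star x = 0 -> x = 0.
Proof. by move=> x0; rewrite -[x]starK x0 star0. Qed.

Lemma starX x n : star (x ^+ n) = star x ^+ n.
Proof. by elim: n => [|n IHn]; rewrite ?star1 // exprS starM IHn exprSr. Qed.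

Lemma projection_compl e : projection e -> projection (1 - e).
Proof.
case=> ee se; split; last by rewrite starD starN star1 se.
by rewrite expr2 mulrBr mulr1 mulrBl mul1r -expr2 ee subrr subr0.
Qed.

Lemma idempotentX e n : e ^+ 2 = e -> (0 < n)%N -> e ^+ n = e.
Proof.
by move=> ee; case: n => // n _; elim: n => // n IHn; rewrite exprS IHn.
Qed.

Lemma nilpotent_star x : nilpotent_elt (star x) -> nilpotent_elt x.
Proof.
by case=> n n0 xn; exists n => //; apply: star_eq0; rewrite starX.
Qed.

Lemma zero_divisor_star x : zero_divisor x -> zero_divisor (star x).
Proof.
case=> [->|[y y0 xy]]; first by left; rewrite star0.
right; exists (star y); first by move/star_eq0.
by rewrite -!starM; case: xy => ->; rewrite star0; [right | left].
Qed.

Lemma zero_divisorX x n : (0 < n)%N -> zero_divisor x -> zero_divisor (x ^+ n).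
Proof.
case: n => // n _ [->|[y y0 xy]]; first by left; rewrite exprS mul0r.
right; exists y => //; case: xy => xy; [left | right].
  by rewrite exprSr -mulrA xy mulr0.
by rewrite exprS mulrA xy mul0r.
Qed.

Lemma nilpotent_zero_divisor x : nilpotent_elt x -> zero_divisor x.
Proof.
case=> n _; elim: n => [|n IHn] xn.
  (* Positivity of the exponent was dropped for the induction; a vanishing zeroth power means
     [1 = 0], so [x = 0]. *)
  by left; rewrite -[x]mulr1 -(expr0 x) xn mulr0.
have [xn0|/eqP xn0] := eqVneq (x ^+ n) 0; first exact: IHn.
by right; exists (x ^+ n) => //; left; rewrite -exprS.
Qed.

(** Nilpotency of [x] makes [1 - x] a unit, with the finite geometric series [s] as inverse. Since
    [e] is a central idempotent, some power of this unit annihilates [e], which forces [e = 0]. *)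
Lemma idempotent_nilpotent_eq0 e x : (forall y, e * y = y * e) -> e ^+ 2 = e ->
  nilpotent_elt x -> nilpotent_elt (e * (1 - x)) -> e = 0.
Proof.
move=> ce ee [n _ xn] [m m0 exm].
have em : e * (1 - x) ^+ m = 0.
  by rewrite -[e in e * _](idempotentX ee m0) // -exprMn_comm.
pose s := \sum_(i < n) x ^+ i.
have xs : (1 - x) * s = 1.
  by rewrite -[1 - x]opprB mulNr -subrX1 xn sub0r opprK.
have xsm : (1 - x) ^+ m * s ^+ m = 1.
  elim: m {m0 exm em} => [|m IHm]; first by rewrite !expr0 mulr1.
  by rewrite exprSr exprS mulrA -(mulrA _ _ s) xs mulr1.
by rewrite -[e]mulr1 -xsm mulrA em mul0r.
Qed.

(** Under these hypotheses the zero-divisors are exactly the nilpotent elements, so closure under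
    differences is that of the nilradical. *)
Lemma star_ideal_zero_divisor : (forall x y, x * y = y * x) ->
  (forall x, nonzero_zero_divisor x -> nilpotent_elt x) ->
  star_ideal (@zero_divisor R).
Proof.
move=> mulC nilZ.
have nil x : zero_divisor x -> nilpotent_elt x.
  have [-> _|/eqP x0 Zx] := eqVneq x 0; first by exists 1%N.
  by apply: nilZ.
split; last exact: zero_divisor_star.
split; first by left.
- move=> x y /nil[n n0 xn] /nil[m _ ym]; apply: nilpotent_zero_divisor.
  exists (n + m)%N; first by rewrite addn_gt0 n0.
  rewrite exprBn_comm; last exact: mulC.
  (* In each binomial term either [y] has exponent at least [m] or [x] has exponent at least [n]. *)
  apply: big1 => i _; have [ni|im] := leqP m i.
    by rewrite -(subnK ni) (exprD y) ym !mulr0 mul0rn.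
  have nk : (n <= n + m - i)%N by rewrite -addnBA ?leq_addr // ltnW.
  by rewrite -(subnK nk) (exprD x) xn !mulr0 mul0r mul0rn.
- move=> a x Zx; suff Zax : zero_divisor (a * x) by rewrite -(mulC a x).
  case: Zx => [->|[y y0 xy]]; first by left; rewrite mulr0.
  right; exists y => //; left; rewrite -mulrA.
  by case: xy => [->|yx]; rewrite ?mulr0 // (mulC x) yx mulr0.
Qed.

End StarRingLemmas.

(** * The ring morphism onto the two-element field given by an atom *)

Section AtomCharacter.
Variables (R : starRingType) (e : R).
Hypotheses (ce : forall x : R, e * x = x * e) (pe : projection e) (e0 : e <> 0).
Hypothesis atom : forall x : R, e * x = 0 \/ e * x = e.

(* With [e R = {0, e}], this is the quotient map of [R] by [(1 - e) R]. *)
Definition atom_char (x : R) : 'Z_2 := (e * x != 0)%:R.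

Let ee : e * e = e. Proof. by case: pe. Qed.
Let neq0 : (e == 0) = false. Proof. by apply/eqP. Qed.

(** Being a multiple of [e], the sum is [0] or [e], and the latter would give [e = 0]. This is the
    case [1 + 1 = 0] of additivity below. *)
Lemma atom_double : e + e = 0.
Proof.
have [|] := atom (e + e); rewrite mulrDr ee // => /eqP.
by rewrite -subr_eq0 addrK neq0.
Qed.

Lemma atom_charD : {morph atom_char : x y / x + y}.
Proof.
move=> x y; rewrite /atom_char mulrDr.
by case: (atom x) => ->; case: (atom y) => ->;
  rewrite ?atom_double ?add0r ?addr0 ?neq0 ?eqxx //=; apply: val_inj.
Qed.

Lemma atom_char1 : atom_char 1 = 1.
Proof. by rewrite /atom_char mulr1 neq0. Qed.

Lemma atom_charM : {morph atom_char : x y / x * y}.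
Proof.
(* Writing [e] as [e * e] and moving one factor past [x] turns [e * (x * y)] into
   [(e * x) * (e * y)]. *)
move=> x y; rewrite /atom_char -{1}ee -(mulrA e) (ce (x * y)) -mulrA -ce mulrA.
by case: (atom x) => ->; case: (atom y) => ->;
  rewrite ?ee ?mul0r ?mulr0 ?neq0 ?eqxx //=; apply: val_inj.
Qed.

Lemma atom_char_star x : atom_char (star x) = atom_char x.
Proof.
rewrite /atom_char; congr ((~~ _)%:R).
have se : star (e * x) = e * star x by rewrite starM (proj2 pe) ce.
by rewrite -se; apply/eqP/eqP => [/star_eq0|->] //; rewrite star0.
Qed.

Lemma atom_charK x : (if atom_char x == 0 then 0 else e) = e * x.
Proof. by rewrite /atom_char; case: (atom x) => ->; rewrite ?eqxx ?neq0. Qed.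

End AtomCharacter.

(** * Splitting along two complementary atoms *)

Section TwoAtoms.
Variables (R : starRingType) (e : R).
Hypotheses (ce : forall x : R, e * x = x * e) (pe : projection e).
Hypotheses (e_neq0 : e <> 0) (e_neq1 : 1 - e <> 0).
Hypothesis atom : forall x : R, e * x = 0 \/ e * x = e.
Hypothesis atomC : forall x : R, (1 - e) * x = 0 \/ (1 - e) * x = 1 - e.

Let ceC (x : R) : (1 - e) * x = x * (1 - e).
Proof. by rewrite mulrBl mulrBr mul1r mulr1 ce. Qed.

(** Peirce decomposition: [x = e * x + (1 - e) * x], where each summand is determined by one bit.
    The map [g] below rebuilds [x] from the two bits. *)
Lemma two_atoms_star_isomorphic : star_isomorphic R ('Z_2 * 'Z_2)%type.
Proof.
have peC := projection_compl pe.
have eeC : e * (1 - e) = 0 by rewrite mulrBr mulr1 -expr2 (proj1 pe) subrr.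
pose f (x : R) : 'Z_2 * 'Z_2 := (atom_char e x, atom_char (1 - e) x).
have fD : nmod_morphism f.
  by split=> [|x y]; rewrite /f ?atom_charD // /atom_char !mulr0 eqxx.
have fM : monoid_morphism f.
  by split=> [|x y]; rewrite /f ?atom_charM ?atom_char1.
pose fA := GRing.isNmodMorphism.Build R ('Z_2 * 'Z_2)%type f fD.
pose fR := GRing.isMonoidMorphism.Build R ('Z_2 * 'Z_2)%type f fM.
pose F : {rmorphism R -> 'Z_2 * 'Z_2} := HB.pack f fA fR.
exists F; split; last by move=> x; rewrite /= /f !atom_char_star.
pose g (z : 'Z_2 * 'Z_2) : R :=
  (if z.1 == 0 then 0 else e) + (if z.2 == 0 then 0 else 1 - e).
exists g => [x|z].
  by rewrite /= /f /g /= !atom_charK // -mulrDl addrC subrK mul1r.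
rewrite /= /f /g /atom_char !mulrDr.
have E2 (a : 'Z_2) : a = (a != 0)%:R by case: a => [[|[|//]] i]; apply: val_inj.
case: z => a b /=; rewrite [in RHS](E2 a) [in RHS](E2 b).
have := e_neq0 => /eqP/negPf n0; have := e_neq1 => /eqP/negPf n1.
case: (a == 0); case: (b == 0);
  by rewrite ?mulr0 ?(ceC e) ?eeC -?expr2 ?(proj1 pe) ?(proj1 peC)
    ?addr0 ?add0r ?eqxx ?n0 ?n1.
Qed.

End TwoAtoms.

(** * Both conditions imply completeness *)

Lemma Z2xZ2_cases (z : 'Z_2 * 'Z_2) : [\/ z = 0, z = 1, z = (1, 0) | z = (0, 1)].
Proof.
have E2 (a : 'Z_2) : a = 0 \/ a = 1.
  by case: a => [[|[|//]] i]; [left | right]; apply: val_inj.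
case: z => a b; case: (E2 a) => ->; case: (E2 b) => ->;
  by [apply: Or41 | apply: Or44 | apply: Or43 | apply: Or42].
Qed.

(** Injectivity excludes the images [0] and [1]: they would force [x = 0] or [x = 1], and the unit
    is not a zero-divisor when some [y <> 0] exists. *)
Lemma Z2xZ2_zero_divisor (R : starRingType) (f : {rmorphism R -> 'Z_2 * 'Z_2})
    (x : R) : injective f -> nonzero_zero_divisor x ->
  f x = (1, 0) \/ f x = (0, 1).
Proof.
move=> injf [[//|[y y0 xy]] x0].
have [fx|fx|fx|fx] := Z2xZ2_cases (f x).
- by case: x0; apply: injf; rewrite fx rmorph0.
- have x1 : x = 1 by apply: injf; rewrite fx rmorph1.
  by case: y0; move: xy; rewrite x1 mulr1 mul1r; case.
- by left.
- by right.
Qed.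

Lemma complete_of_Z2xZ2 (R : starRingType) :
  star_isomorphic R ('Z_2 * 'Z_2)%type ->
  complete (generalized_zero_divisor_graph R).
Proof.
move=> [f [/bij_inj injf fstar]] x y Zx Zy xy; split=> //.
(* Distinct vertices map to [(1, 0)] and [(0, 1)], which are fixed by the involution and have
   product zero. *)
exists 1%N => //; left; apply: (injf).
rewrite expr1 rmorph0 rmorphM fstar.
case: (Z2xZ2_zero_divisor injf Zx) (Z2xZ2_zero_divisor injf Zy)
  => fx [fy|fy]; rewrite fx fy; try by congr (_, _); apply: val_inj.
  by case: xy; apply: injf; rewrite fx fy.
by case: xy; apply: injf; rewrite fx fy.
Qed.

Lemma complete_of_nilpotent (R : starRingType) :
  (forall x : R, nonzero_zero_divisor x -> nilpotent_elt x) ->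
  complete (generalized_zero_divisor_graph R).
Proof.
move=> nilZ x y Zx Zy xy; split=> //.
by have [n n0 xn] := nilZ x Zx; exists n => //; left; rewrite xn mul0r.
Qed.

(** * Consequences of completeness *)

Section Complete.
Variable R : starRingType.
Hypothesis abelianR : abelian_star_ring R.
Hypothesis completeR : complete (generalized_zero_divisor_graph R).

Lemma nilpotent_or_projection (x : R) :
  nonzero_zero_divisor x -> nilpotent_elt x \/ projection x.
Proof.
move=> [Zx x0].
have [sx|/eqP sx] := eqVneq (star x) x; last first.
  have [||_ _ _ [n _]] := @completeR x (star x) _ _ (nesym sx) => //.
    (* Adjacency of [x] and [star x] kills a power of [x] or of [star x], because
       [star (star x) = x]. *)
    by split; [apply: zero_divisor_star | move/star_eq0].
  rewrite starK -!exprSr => xn; left; case: xn => xn; first by exists n.+1.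
  by apply: nilpotent_star; exists n.+1.
have [x2|/eqP x2] := eqVneq (x ^+ 2) x; first by right.
(* The square has to be non-zero to be a vertex. *)
left; have [x20|/eqP x20] := eqVneq (x ^+ 2) 0; first by exists 2%N.
have [||_ _ _ [n _]] := @completeR x (x ^+ 2) _ _ (nesym x2) => //.
  by split=> //; apply: zero_divisorX.
rewrite starX sx -exprM => -[|] xn.
  by exists (n + 2)%N; rewrite ?addn2 // -addn2 exprD.
by exists (2 * n).+1; rewrite // exprSr.
Qed.

Lemma projection_atom (e : R) : projection e -> e <> 0 -> 1 - e <> 0 ->
  forall x : R, e * x = 0 \/ e * x = e.
Proof.
move=> pe e0 e1; have ce := abelianR pe; have [ee se] := pe.
have eeC : e * (1 - e) = 0 by rewrite mulrBr mulr1 -expr2 ee subrr.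
have Z y : e * y <> 0 -> nonzero_zero_divisor (e * y).
  move=> ey0; split=> //; right; exists (1 - e) => //.
  by left; rewrite ce -mulrA eeC mulr0.
have nil y : e * y <> e -> nilpotent_elt (e * y).
  move=> eye; have [->|/eqP ey0] := eqVneq (e * y) 0; first by exists 1%N.
  have [|_ _ _ [n n0]] := @completeR (e * y) e (Z _ ey0) _ eye.
    by have := Z 1; rewrite mulr1; apply.
  (* In the first case, multiplying by [y] on the right gives a zero power of [e * y]; in the
     second, [e] fixes [star (e * y)], so [e * y = 0], a contradiction. *)
  rewrite se (idempotentX ee n0) => -[eyn|esy].
    by exists n.+1; rewrite // exprSr mulrA eyn mul0r.
  by case: ey0; apply: star_eq0; move: esy; rewrite starM se -ce mulrA -expr2 ee.
move=> x; have [|/eqP ex0] := eqVneq (e * x) 0; first by left.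
have [|/eqP exe] := eqVneq (e * x) e; first by right.
(* If [e * x] is neither [0] nor [e], then neither [e * x] nor [e - e * x] equals [e], so both are
   nilpotent. *)
case: e0; apply: (idempotent_nilpotent_eq0 (x := e * x)) => //; first exact: nil.
apply: nil; rewrite mulrBr mulr1 mulrA -expr2 ee => /eqP.
by rewrite subr_eq -subr_eq0 opprD addrA subrr sub0r oppr_eq0 => /eqP.
Qed.

Lemma star_isomorphic_of_projection (e : R) :
  projection e -> e <> 0 -> 1 - e <> 0 ->
  star_isomorphic R ('Z_2 * 'Z_2)%type.
Proof.
move=> pe e0 e1; apply: (two_atoms_star_isomorphic (e := e)) => //.
- exact: abelianR.
- exact: projection_atom.
- apply: projection_atom => //; first exact: projection_compl.
  by rewrite opprB addrC subrK.
Qed.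

End Complete.

(** * Transfer along graph isomorphisms, and both claims together *)

Lemma complete_graph_isomorphic (T U : Type)
    (G : simple_graph T) (H : simple_graph U) :
  graph_isomorphic G H -> complete H -> complete G.
Proof.
move=> [f [fV injf _ fadj]] HC x y Vx Vy xy; apply/(fadj x y) => //.
by apply: HC; [exact: fV | exact: fV | move/injf => H0; apply: xy; exact: H0].
Qed.

Unset Implicit Arguments.

Theorem theorem3p2 (R : starRingType) (abelianR : abelian_star_ring R) :
  (complete (generalized_zero_divisor_graph R) <->
     star_isomorphic R ('Z_2 * 'Z_2)%type \/
     (forall x : R, nonzero_zero_divisor x -> nilpotent_elt x)) /\
  ((forall x y : R, x * y = y * x) ->
   forall n : nat, (2 < n)%N ->
     graph_isomorphic (generalized_zero_divisor_graph R) (complete_graph n) ->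
     star_ideal (@zero_divisor R)).
Proof.
have main : complete (generalized_zero_divisor_graph R) ->
     star_isomorphic R ('Z_2 * 'Z_2)%type \/
     (forall x : R, nonzero_zero_divisor x -> nilpotent_elt x).
  (* Deciding the isomorphism first lets each vertex be treated separately: one that is a projection
     would already yield the isomorphism. *)
  move=> C; have [|niso] := boolp.EM (star_isomorphic R ('Z_2 * 'Z_2)%type).
    by left.
  right=> x Zx; have [//|px] := nilpotent_or_projection C Zx.
  have [[//|[y y0 xy]] x0] := Zx.
  case: niso; apply: (star_isomorphic_of_projection abelianR C (e := x)) => //.
  move=> /eqP; rewrite subr_eq0 eq_sym => /eqP x1.
  by case: y0; move: xy; rewrite x1 mulr1 mul1r; case.
split.
  split; first exact: main.
  by case; [exact: complete_of_Z2xZ2 | exact: complete_of_nilpotent].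
move=> mulC n n2 iso.
have C : complete (generalized_zero_divisor_graph R).
  by apply: complete_graph_isomorphic iso _ => i j.
have [[f [/bij_inj injf _]]|] := main C; last exact: star_ideal_zero_divisor.
case: iso => h [_ _ surj _].
(* Pigeonhole: as [2 < n] there are three distinct vertices, but [f] embeds all vertices into the
   pair [(1, 0)], [(0, 1)]. *)
pose o k (kn : (k < 3)%N) : 'I_n := Ordinal (leq_trans kn n2).
have [x Zx hx] := surj (o 0%N isT) I.
have [y Zy hy] := surj (o 1%N isT) I.
have [z Zz hz] := surj (o 2%N isT) I.
have neq (u v : R) : h u <> h v -> f u <> f v.
  by move=> huv /injf uv; case: huv; rewrite uv.
have xy : f x <> f y by apply: neq; rewrite hx hy => /(congr1 val).
have xz : f x <> f z by apply: neq; rewrite hx hz => /(congr1 val).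
have yz : f y <> f z by apply: neq; rewrite hy hz => /(congr1 val).
by case: (Z2xZ2_zero_divisor injf Zx) xy xz => ->;
  case: (Z2xZ2_zero_divisor injf Zy) yz => ->;
  case: (Z2xZ2_zero_divisor injf Zz) => ->.
Qed.
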